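(* Let $G$ be a triangle-free graph on $n$ vertices, with minimum degree $\delta(G)$ and chromatic number $\chi(G)$. (a) If $\delta(G)>\frac{10n}{29}$, then $G$ is not $\left(\frac12,\frac1{50}\right)$-dense. (b) If $\delta(G)>\frac n3$ and $\chi(G)\le 3$, then $G$ is not $\left(\frac12,\frac1{50}\right)$-dense.
   Context: All graphs are finite and simple. An $n$-vertex graph $G$ is called $(\alpha,\beta)$-dense if every subset of $\lfloor \alpha n\rfloor$ vertices of $G$ spans (induces) more than $\beta n^2$ edges. *)

(* Defs.v *)
From mathcomp Require Import all_boot all_order all_algebra.

Set Implicit Arguments.
Unset Strict Implicit.
Unset Printing Implicit Defensive.

Import Order.TTheory GRing.Theory Num.Theory.

Record sgraph := SGraph {
  svertex :> finType;
  adj : rel svertex;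
  adj_sym : symmetric adj;
  adj_irrefl : irreflexive adj }.

Definition degree (G : sgraph) (x : G) : nat := #|[set y : G | adj x y]|.

(* The default #|G| exceeds every degree, so for a nonempty graph this is the
   minimum over the vertices; the graph without vertices gets 0. *)
Definition min_degree (G : sgraph) : nat :=
  \big[minn/#|G|]_(x : G) degree x.

Definition triangle_free (G : sgraph) : Prop :=
  forall x y z : G, ~~ [&& adj x y, adj y z & adj x z].

Definition colorable (G : sgraph) (k : nat) : bool :=
  [exists f : {ffun G -> 'I_k},
     [forall x : G, [forall y : G, adj x y ==> (f x != f y)]]].

Lemma colorable_exists (G : sgraph) : exists k, colorable G k.
Proof.
exists #|G|; apply/existsP; exists [ffun x => enum_rank x].
apply/forallP => x; apply/forallP => y; apply/implyP => xy.
rewrite !ffunE; apply: contraTneq xy => /enum_rank_inj ->.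
by rewrite adj_irrefl.
Qed.

Definition chromatic_number (G : sgraph) : nat := ex_minn (colorable_exists G).

(* Edges are unordered: each one is counted once, as a two-element set. *)
Definition edges (G : sgraph) : {set {set G}} :=
  [set [set p.1; p.2] | p : G * G & adj p.1 p.2].

Definition edges_in (G : sgraph) (S : {set G}) : {set {set G}} :=
  [set e in edges G | e \subset S].

Local Open Scope ring_scope.

Definition is_dense (R : archiRealFieldType) (alpha beta : R) (G : sgraph)
  : Prop :=
  forall S : {set G}, (#|S|)%:Z = Num.floor (alpha * #|G|%:R) ->
    beta * #|G|%:R ^+ 2 < #|edges_in S|%:R.

(* Main.v *)
Require Import Defs.
From mathcomp Require Import all_boot all_order all_algebra.
From mathcomp Require Import zify ring lra.
Import Order.TTheory GRing.Theory Num.Theory.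

Set Implicit Arguments.
Unset Strict Implicit.
Unset Printing Implicit Defensive.

(* Let n be the number of vertices and d > n/3 the minimum degree. Adding edges
   only makes the graph denser, so G may be taken edge-maximal among the
   triangle-free graphs (for (a)) or the triangle-free 3-colourable graphs (for
   (b)). Then nonadjacent vertices have a common neighbour and there is no
   induced hexagon:
   - since 6 d > 2 n, every hexagon has a vertex adjacent to three alternate
     vertices of it; in (b) this is impossible for a hexagon coloured 123123,
     which rules out an induced matching of two edges between two colour classes,
     and every 3-colouring of an induced hexagon produces such a matching;
   - in (a), an induced hexagon together with common neighbours of its antipodal
     pairs and the vertices forced by counting degrees contains a weighted
     configuration of total weight 29 of which no vertex sees more than 10.

   Without induced hexagons every three independent vertices have a common
   neighbour, and G looks like a circular graph. Let A be a largest
   neighbourhood, a = |A|, and call N(z) n A the trace of z. A vertex c of A in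
   a smallest trace has the property that the traces of its neighbours form a
   chain. The sparse half consists of A and the h = n/2 - a vertices z of N(c)
   with the smallest traces M(z). If t of them have a trace smaller than M(z)
   and t' a trace at most M(z), then |M(z)| <= 3 a - n + t and
   |M(z)| <= a - d + t', and summing over z gives the bound n^2/50 as long as
   a <= 2 n/5. For larger a, the h vertices can also be taken on the other side
   of A, where their traces avoid the largest trace M used on the first side;
   the better of the two choices spans at most h min(|M|, a - |M|) <= h a / 2
   edges. *)

(** * Weighted degree counting *)

Fixpoint bitseqs (k : nat) : seq bitseq :=
  if k is k'.+1 then
    map (cons true) (bitseqs k') ++ map (cons false) (bitseqs k')
  else [:: [::]].

Lemma mem_bitseqs (s : bitseq) : s \in bitseqs (size s).
Proof.
by elim: s => //= b s IHs; rewrite mem_cat; case: b;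
  rewrite map_f ?orbT.
Qed.

(* A bit sequence stands for the adjacencies of one vertex to a list of vertices
   with weights ws, among which the pairs of indices in E are adjacent. The
   sequence then selects no pair of E, and the test says that it has weight at
   most b or selects all the indices of some member of F. *)
Definition independent_bits (E : seq (nat * nat)) (s : bitseq) : bool :=
  all (fun p => ~~ (nth false s p.1 && nth false s p.2)) E.

Definition light_or_forced (E : seq (nat * nat)) (ws : seq nat) (b : nat)
    (F : seq (seq nat)) : bool :=
  all (fun s => independent_bits E s ==>
         (sumn (mask s ws) <= b) || has (all (nth false s)) F)
    (bitseqs (size ws)).

Lemma ltn_3_of_10_29 (n d : nat) : 10 * n < 29 * d -> n < 3 * d.
Proof. by lia. Qed.

Section DenseTriangleFree.

Variables (T : finType) (e : rel T) (d : nat).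
Hypothesis e_sym : symmetric e.
Hypothesis e_tf : forall x y z, ~~ [&& e x y, e y z & e x z].
Hypothesis e_deg : forall x, d <= #|[set y | e x y]|.

(** Double counting: a listed vertex of weight [k] contributes [k] at each of its at least [d]
    neighbours. *)
Lemma sum_mask_degree (t : seq T) (ws : seq nat) : size t = size ws ->
  sumn ws * d <= \sum_(w : T) sumn (mask (map (e w) t) ws).
Proof.
elim: t ws => [|x t IHt] [|k ws] //= [sz].
have -> : \sum_w sumn (mask (e w x :: map (e w) t) (k :: ws)) =
          \sum_w (e w x * k) + \sum_w sumn (mask (map (e w) t) ws).
  by rewrite -big_split; apply: eq_bigr => w _; rewrite mask_cons sumn_cat;
    case: (e w x); rewrite /= ?mul1n ?addn0.
rewrite mulnDl leq_add ?IHt // -big_distrl /= mulnC leq_mul2r.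
rewrite (leq_trans (e_deg x)) ?orbT // -sum1dep_card big_mkcond /=.
by rewrite leq_sum // => w _; rewrite (e_sym x); case: (e w x).
Qed.

(** Otherwise every vertex sees weight at most [b], as its neighbourhood contains no pair of [E];
    this contradicts [sum_mask_degree]. Positions are counted, so [t] may repeat vertices. *)
Lemma forced_neighbour (x0 : T) (t : seq T) (E : seq (nat * nat))
    (ws : seq nat) (b : nat) (F : seq (seq nat)) :
  size t = size ws -> light_or_forced E ws b F ->
  all (fun p => e (nth x0 t p.1) (nth x0 t p.2)) E ->
  b * #|T| < sumn ws * d ->
  exists w, has (all (fun i => (i < size t) && e w (nth x0 t i))) F.
Proof.
move=> sz /allP chk /allP tE lt_b.
case: (pickP (fun w => has (all (fun i => (i < size t) && e w (nth x0 t i))) F)).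
  by move=> w Fw; exists w.
move=> noF; suff: sumn ws * d <= b * #|T| by rewrite leqNgt lt_b.
apply: leq_trans (sum_mask_degree sz) _.
rewrite mulnC -sum_nat_const leq_sum // => w _.
have nthE i : nth false (map (e w) t) i = (i < size t) && e w (nth x0 t i).
  case: (ltnP i (size t)) => lti; first by rewrite (nth_map x0).
  by rewrite nth_default ?size_map.
have memw : map (e w) t \in bitseqs (size ws).
  by rewrite -sz -(size_map (e w)) mem_bitseqs.
have /implyP {}chk := chk _ memw.
have /chk/orP[//|] : independent_bits E (map (e w) t).
  apply/allP => -[i j] /tE /= eij; rewrite !nthE.
  apply: contra (e_tf w (nth x0 t i) (nth x0 t j)).
  by case/andP => /andP[_ ->] /andP[_ ->]; rewrite eij.
suff -> : has (all (nth false (map (e w) t))) F =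
  has (all (fun i => (i < size t) && e w (nth x0 t i))) F by rewrite noF.
by apply: eq_has => S; apply: eq_all => i; rewrite nthE.
Qed.

Lemma hexagon (v1 v2 v3 v4 v5 v6 : T) : #|T| < 3 * d ->
  e v1 v2 -> e v2 v3 -> e v3 v4 -> e v4 v5 -> e v5 v6 -> e v6 v1 ->
  exists w, [&& e w v1, e w v3 & e w v5] || [&& e w v2, e w v4 & e w v6].
Proof.
move=> dT e12 e23 e34 e45 e56 e61.
have [||||w] := @forced_neighbour v1 [:: v1; v2; v3; v4; v5; v6]
  [:: (0, 1); (1, 2); (2, 3); (3, 4); (4, 5); (5, 0)] (nseq 6 1) 2
  [:: [:: 0; 2; 4]; [:: 1; 3; 5]] => //.
- by rewrite /= e12 e23 e34 e45 e56 e61.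
- by rewrite (_ : sumn _ = 2 * 3) // -mulnA ltn_pmul2l.
by rewrite /= !andbT orbF; exists w.
Qed.

Lemma no_weighted_configuration (x0 : T) (t : seq T) (E : seq (nat * nat))
    (ws : seq nat) : 10 * #|T| < 29 * d ->
  [&& size t == size ws, light_or_forced E ws 10 [::], sumn ws == 29 &
    all (fun p => e (nth x0 t p.1) (nth x0 t p.2)) E] -> False.
Proof.
move=> dT /and4P[/eqP sz chk /eqP s29 tE].
by have [|//] := forced_neighbour sz chk tE; rewrite s29.
Qed.

(** * Hexagons whose antipodal pairs have common neighbours *)

Section HexagonWithChords.

Variables v1 v2 v3 v4 v5 v6 a b c w : T.
Hypothesis dT : 10 * #|T| < 29 * d.
Hypotheses (e12 : e v1 v2) (e23 : e v2 v3) (e34 : e v3 v4) (e45 : e v4 v5)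
  (e56 : e v5 v6) (e61 : e v6 v1).
Hypotheses (ea1 : e a v1) (ea4 : e a v4) (eb2 : e b v2) (eb5 : e b v5)
  (ec3 : e c v3) (ec6 : e c v6).
Hypotheses (ew1 : e w v1) (ew3 : e w v3) (ew5 : e w v5).

(* The indices refer to v1, ..., v6, a, b, c, w, p, r, s in this order. The
   weights below are optimal solutions of the linear program that bounds the
   minimum degree of a triangle-free graph containing these edges. *)
Let E0 := [:: (0, 1); (1, 2); (2, 3); (3, 4); (4, 5); (5, 0); (6, 0); (6, 3);
  (7, 1); (7, 4); (8, 2); (8, 5); (9, 0); (9, 2); (9, 4);
  (10, 1); (10, 4); (10, 6)].

(** Here [p] takes over from [b], which gets weight 0 in every leaf. Two more forced vertices [r]
    and [s] leave four cases, each refuted by a weighting of total 29. *)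
Lemma chorded_hexagon_forced_p p : e p v2 -> e p v5 -> e p a -> False.
Proof.
move=> ep2 ep5 epa.
have dT3 := ltn_3_of_10_29 dT.
have leaf r s E ws : [&& size ws == 13, light_or_forced (E0 ++ E) ws 10 [::],
    sumn ws == 29 & all (fun q => e
      (nth v1 [:: v1; v2; v3; v4; v5; v6; a; b; c; w; p; r; s] q.1)
      (nth v1 [:: v1; v2; v3; v4; v5; v6; a; b; c; w; p; r; s] q.2)) E] -> False.
  case/and4P=> szw chk s29 tE; apply: (@no_weighted_configuration v1
    [:: v1; v2; v3; v4; v5; v6; a; b; c; w; p; r; s] (E0 ++ E) ws dT).
  rewrite (eqP szw) chk s29 all_cat tE /= e12 e23 e34 e45 e56 e61.
  by rewrite ea1 ea4 eb2 eb5 ec3 ec6 ew1 ew3 ew5 ep2 ep5 epa.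
(* Since 9 d > 3 n, some [r] sees four of these nine vertices, and an independent set of that size
   contains one of the two listed quadruples. *)
have [||||r] := @forced_neighbour v1 [:: v1; v2; v3; v4; v5; v6; a; c; p]
  [:: (0, 1); (1, 2); (2, 3); (3, 4); (4, 5); (5, 0); (6, 0); (6, 3); (7, 2);
    (7, 5); (8, 1); (8, 4); (8, 6)]
  (nseq 9 1) 3 [:: [:: 1; 4; 6; 7]; [:: 0; 3; 7; 8]] => //.
- by rewrite /= e12 e23 e34 e45 e56 e61 ea1 ea4 ec3 ec6 ep2 ep5 epa.
- by rewrite (_ : sumn _ = 9) // (_ : 9 = 3 * 3) // -mulnA ltn_pmul2l.
rewrite /= !andbT orbF => /orP[]/and4P[er1 er2 er3 er4].
  have [|||s] := @hexagon v3 v4 a v1 v6 c dT3 e34 _ ea1 _ _ ec3.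
  - by rewrite e_sym.
  - by rewrite e_sym.
  - by rewrite e_sym.
  case/orP=> /and3P[es1 es2 es3].
  - apply: (leaf r s [:: (11, 1); (11, 4); (11, 6); (11, 8);
      (12, 2); (12, 5); (12, 6)] [:: 3; 2; 4; 2; 3; 3; 3; 0; 2; 2; 0; 3; 2]).
    by rewrite /= er1 er2 er3 er4 es1 es2 es3 !andbT; vm_compute.
  - apply: (leaf r s [:: (11, 1); (11, 4); (11, 6); (11, 8);
      (12, 0); (12, 3); (12, 8)] [:: 4; 2; 3; 3; 3; 2; 2; 0; 3; 2; 0; 3; 2]).
    by rewrite /= er1 er2 er3 er4 es1 es2 es3 !andbT; vm_compute.
have [|||s] := @hexagon v2 v3 c v6 v5 p dT3 e23 _ ec6 _ _ ep2.
- by rewrite e_sym.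
- by rewrite e_sym.
- by rewrite e_sym.
case/orP=> /and3P[es1 es2 es3].
- apply: (leaf r s [:: (11, 0); (11, 3); (11, 8); (11, 10);
    (12, 1); (12, 4); (12, 8)] [:: 3; 3; 3; 2; 4; 2; 0; 0; 3; 2; 2; 3; 2]).
  by rewrite /= er1 er2 er3 er4 es1 es2 es3 !andbT; vm_compute.
- apply: (leaf r s [:: (11, 0); (11, 3); (11, 8); (11, 10);
    (12, 2); (12, 5); (12, 10)] [:: 3; 2; 4; 2; 3; 3; 1; 0; 2; 2; 3; 2; 2]).
  by rewrite /= er1 er2 er3 er4 es1 es2 es3 !andbT; vm_compute.
Qed.

End HexagonWithChords.

(** The hexagon [v1 v2 b v5 v4 a] forces a [p] adjacent to [v2], [v5], [a] or to [v1], [v4], [b].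
    The reflection fixing [v3] and [v6] swaps [a] with [b] and turns the second case into the
    first. *)
Lemma chorded_hexagon_forced_w v1 v2 v3 v4 v5 v6 a b c w : 10 * #|T| < 29 * d ->
  [&& e v1 v2, e v2 v3, e v3 v4, e v4 v5, e v5 v6 & e v6 v1] ->
  [&& e a v1, e a v4, e b v2, e b v5, e c v3 & e c v6] ->
  [&& e w v1, e w v3 & e w v5] -> False.
Proof.
move=> dT /and5P[e12 e23 e34 e45 /andP[e56 e61]].
move=> /and5P[ea1 ea4 eb2 eb5 /andP[ec3 ec6]] /and3P[ew1 ew3 ew5].
have dT3 := ltn_3_of_10_29 dT.
have [|||p] := @hexagon v1 v2 b v5 v4 a dT3 e12 _ eb5 _ _ ea1.
- by rewrite e_sym.
- by rewrite e_sym.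
- by rewrite e_sym.
case/orP=> /and3P[ep1 ep2 ep3].
- apply: (@chorded_hexagon_forced_p v5 v4 v3 v2 v1 v6 b a c w dT) ep3 ep1 ep2 => //;
  by rewrite e_sym.
- exact: (@chorded_hexagon_forced_p v1 v2 v3 v4 v5 v6 a b c w dT) ep1 ep2 ep3.
Qed.

Lemma no_chorded_hexagon v1 v2 v3 v4 v5 v6 a b c : 10 * #|T| < 29 * d ->
  [&& e v1 v2, e v2 v3, e v3 v4, e v4 v5, e v5 v6 & e v6 v1] ->
  [&& e a v1, e a v4, e b v2, e b v5, e c v3 & e c v6] -> False.
Proof.
move=> dT hex chd; have /and5P[e12 e23 e34 e45 /andP[e56 e61]] := hex.
have /and5P[ea1 ea4 eb2 eb5 /andP[ec3 ec6]] := chd.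
have dT3 := ltn_3_of_10_29 dT.
have [w /orP[ew|/and3P[ew2 ew4 ew6]]] := hexagon dT3 e12 e23 e34 e45 e56 e61.
- exact: chorded_hexagon_forced_w dT hex chd ew.
- apply: (@chorded_hexagon_forced_w v2 v3 v4 v5 v6 v1 b c a w dT).
  + by rewrite e12 e23 e34 e45 e56 e61.
  + by rewrite ea1 ea4 eb2 eb5 ec3 ec6.
  + by rewrite ew2 ew4 ew6.
Qed.

End DenseTriangleFree.

(** * Graphs without induced hexagons *)

Section Arithmetic.

Local Open Scope ring_scope.

(* With b = 3 a - n, the hypotheses give m <= b + t and both
   x <= 2 b t / 3 + t^2 / 2 and x <= t (b / 3 + t); the first bound on x
   suffices when b <= 3 n / 20 and the second one otherwise. *)
Lemma staircase_bound (R : realFieldType) (n d a h t m x : R) :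
  0 <= n -> 0 <= t -> t <= h -> n <= 3 * d -> 5 * a <= 2 * n -> n <= 3 * a ->
  2 * (h + a) <= n -> m + n <= 3 * a + t ->
  2 * x + t * (n + d) <= 4 * a * t + t * t -> x + t * d <= t * (a + t) ->
  50 * (x + (h - t) * m) <= n * n.
Proof.
move=> n0 t0 th nd an na hn mt x1 x2.
pose b := 3 * a - n.
have b0 : 0 <= b by rewrite /b; lra.
have bn : 5 * b <= n by rewrite /b; lra.
have aE : a = (n + b) / 3 by rewrite /b; field.
have mb : m <= b + t by rewrite /b; lra.
have hb6 : 0 <= n / 6 - b / 3 - h by rewrite /b; lra.
clearbody b.
have td : t * n <= 3 * (t * d) by rewrite mulrCA ler_wpM2l.
have hm : (h - t) * m <= (h - t) * (b + t).
  by rewrite ler_wpM2l ?subr_ge0.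
have [g g0 hE] : exists2 g, 0 <= g & h = n / 6 - b / 3 - g.
  by exists (n / 6 - b / 3 - h); [|ring].
suff : 50 * (x + (h - t) * (b + t)) <= n * n.
  by apply: le_trans; rewrite ler_wpM2l // lerD2l.
case: (lerP (20 * b) (3 * n)) => bn20.
  have x1' : x <= 2 / 3 * (b * t) + t * t / 2 by rewrite aE in x1; lra.
  (* With h = n/6 - b/3 the bound is quadratic in [t], with its maximum at t = n/6 - 2 b / 3. *)
  have sq := sqr_ge0 (t - (n / 6 - 2 / 3 * b)).
  have [s s0 bE] : exists2 s, 0 <= s & b = 3 / 20 * n - s.
    by exists (3 / 20 * n - b); [lra | ring].
  have bg := mulr_ge0 b0 g0; have gt := mulr_ge0 t0 g0.
  have sn := mulr_ge0 s0 n0; have ss := mulr_ge0 s0 s0.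
  have nn := mulr_ge0 n0 n0.
  rewrite expr2 in sq; rewrite hE.
  suff : b * (n / 6 - b / 3) + (n / 6 - 2 / 3 * b) ^+ 2 / 2 <= n * n / 50 by lra.
  by rewrite expr2 bE; lra.
have x2' : x <= t * (b / 3) + t * t by rewrite aE in x2; lra.
suff : t * (b / 3) + t * t + (h - t) * (b + t) <= n * n / 50 by lra.
have -> : t * (b / 3) + t * t + (h - t) * (b + t) = b * h + t * (h - 2 / 3 * b).
  by field.
have h0 : 0 <= h by apply: le_trans th.
(* The bound is linear in [t], so only t = 0 and t = h matter, by the sign of h - 2 b / 3. *)
case: (lerP h (2 / 3 * b)) => hb.
  have : t * (h - 2 / 3 * b) <= 0 by rewrite mulr_ge0_le0 // subr_le0.
  have [s s0 bE] : exists2 s, 0 <= s & b = n / 5 - s.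
    by exists (n / 5 - b); [lra | ring].
  have bg := mulr_ge0 b0 g0.
  suff : b * (n / 6 - b / 3) <= n * n / 50 by rewrite hE; lra.
  have sn := mulr_ge0 s0 n0; have ss := mulr_ge0 s0 s0.
  by rewrite bE; lra.
have : t * (h - 2 / 3 * b) <= h * (h - 2 / 3 * b).
  by rewrite ler_wpM2r // subr_ge0 ltW.
have hs : h <= 7 / 60 * n by lra.
have : h * (b / 3 + h) <= h * (n / 6) by rewrite ler_wpM2l //; lra.
have := ler_wpM2r n0 hs; have := mulr_ge0 n0 n0.
lra.
Qed.

Lemma staircase_bound_nat (n d a h t m x : nat) :
  (t <= h -> n <= 3 * d -> 5 * a <= 2 * n -> n <= 3 * a ->
  2 * (h + a) <= n -> m + n <= 3 * a + t ->
  2 * x + t * (n + d) <= 4 * a * t + t * t -> x + t * d <= t * (a + t) ->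
  50 * (x + (h - t) * m) <= n * n)%N.
Proof.
move=> th nd an na hn mt x1 x2.
suff : 50%:R * (x%:R + (h - t)%:R * m%:R) <= n%:R * n%:R :> rat.
  by rewrite -!natrM -natrD -natrM ler_nat.
rewrite (natrB _ th); apply: (@staircase_bound _ n%:R d%:R a%:R).
- exact: ler0n.
- exact: ler0n.
- by rewrite ler_nat.
- by rewrite -natrM ler_nat.
- by rewrite -!natrM ler_nat.
- by rewrite -natrM ler_nat.
- by rewrite -natrD -natrM ler_nat.
- by rewrite -natrM -!natrD ler_nat.
- by rewrite -!natrD -!natrM -!natrD ler_nat.
- by rewrite -!natrM -!natrD -!natrM ler_nat.
Qed.

End Arithmetic.

Lemma initial_subset (T : finType) (f : T -> nat) (B : {set T}) h :
  h <= #|B| -> exists2 D : {set T}, D \subset B /\ #|D| = h &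
    {in D & B :\: D, forall x y, f x <= f y}.
Proof.
elim: h => [|h IHh] leB.
  by exists set0; [rewrite sub0set cards0 | move=> x y; rewrite inE].
have [D [sDB cD] minD] := IHh (ltnW leB).
have /card_gt0P[z0 z0B] : 0 < #|B :\: D|.
  by rewrite cardsD (setIidPr sDB) cD subn_gt0.
case: (@arg_minnP _ z0 [in B :\: D] f z0B) => z /setDP[zB zND] minz.
exists (z |: D).
  by rewrite subUset sub1set zB sDB cardsU1 zND cD.
move=> x y /setU1P[-> | xD]; rewrite !inE negb_or => /andP[/andP[yNz yND] yB].
  by apply: minz; rewrite inE yND.
by apply: minD; rewrite // inE yND.
Qed.

Lemma sum_nat_of_bool (T : finType) (B : {set T}) (P : pred T) :
  \sum_(x in B) (P x : nat) = #|[set x in B | P x]|.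
Proof.
rewrite -sum1_card big_mkcond [RHS]big_mkcond; apply: eq_bigr => x _.
by rewrite inE; case: (x \in B); case: (P x).
Qed.

(** Exchanging [x] and [y] in one half makes every ordered pair count exactly once, ties
    included. *)
Lemma sum_comparisons (T : finType) (B : {set T}) (f : T -> nat) :
  \sum_(x in B) \sum_(y in B) ((f y < f x) + (f y <= f x)) = #|B| * #|B|.
Proof.
under eq_bigr do rewrite big_split /=.
rewrite big_split /= exchange_big -big_split -sum_nat_const /=.
apply: eq_bigr => x _; rewrite -big_split -sum1_card /=.
by apply: eq_bigr => y _; case: ltnP.
Qed.

(** * Nested and disjoint traces *)

Section HexagonFree.

Variables (T : finType) (e : rel T).
Hypothesis e_sym : symmetric e.
Hypothesis e_tf : forall x y z, ~~ [&& e x y, e y z & e x z].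
Hypothesis e_common : forall x y, ~~ e x y -> exists2 z, e x z & e y z.
Hypothesis e_no_hexagon : forall v1 v2 v3 v4 v5 v6,
  [&& e v1 v2, e v2 v3, e v3 v4, e v4 v5, e v5 v6 & e v6 v1] ->
  [|| e v1 v4, e v2 v5 | e v3 v6].

Let N x := [set y | e x y].

Lemma triangleF x y z : e x y -> e y z -> e x z -> False.
Proof. by move=> xy yz xz; have := e_tf x y z; rewrite xy yz xz. Qed.

Lemma common_neighbour_nonadj x y z : e x z -> e y z -> ~~ e x y.
Proof.
by move=> xz yz; apply/negP=> xy; apply: (triangleF xy yz xz).
Qed.

Lemma irrefl x : ~~ e x x.
Proof. by apply/negP => xx; apply: (triangleF xx xx xx). Qed.

(** Common neighbours of the three pairs complete a hexagon [x u y v z w], and any long diagonal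
    makes one of them adjacent to all three. *)
Lemma common_neighbour3 x y z : ~~ e x y -> ~~ e y z -> ~~ e x z ->
  exists w, [/\ e x w, e y w & e z w].
Proof.
move=> xy yz xz; have [u xu yu] := e_common xy.
have [v yv zv] := e_common yz; have [w xw zw] := e_common xz.
have /or3P[xv|uz|yw] : [|| e x v, e u z | e y w].
  apply: e_no_hexagon; rewrite xu (e_sym u) yu yv (e_sym v) zv zw (e_sym w) xw //.
- by exists v.
- by exists u; rewrite (e_sym z).
- by exists w.
Qed.

Variable v0 : T.
Let A := N v0.
Let M z := N z :&: A.

Lemma inM z x : (x \in M z) = e z x && e v0 x.
Proof. by rewrite !inE. Qed.

Lemma A_indep x y : e v0 x -> e v0 y -> ~~ e x y.
Proof. by move=> x0 y0; apply: (@common_neighbour_nonadj _ _ v0); rewrite e_sym. Qed.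

Lemma A_nbr x y : e v0 x -> e x y -> ~~ e v0 y.
Proof. by move=> x0 xy; apply/negP=> y0; apply: (triangleF x0 xy y0). Qed.

Lemma M_ex z : ~~ e v0 z -> exists x, x \in M z.
Proof. by case/e_common=> x x0 zx; exists x; rewrite inM zx. Qed.

(** In the hexagon [c1 z q z' c2 v0] the only diagonal left is [q v0]. *)
Lemma crossing_traces c1 c2 z z' q : c1 \in M z -> c2 \in M z' ->
  c1 \notin M z' -> c2 \notin M z -> e z q -> e z' q -> e v0 q.
Proof.
rewrite !inM => /andP[zc1 c1A] /andP[zc2 c2A].
rewrite c1A c2A !andbT => zc1' zc2' zq zq'.
have := @e_no_hexagon c1 z q z' c2 v0.
rewrite (e_sym c1 z) zc1 zq (e_sym q) zq' zc2 (e_sym c2) c2A c1A.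
rewrite (e_sym c1) (negbTE zc1') (negbTE zc2') /= => /(_ isT).
by rewrite e_sym.
Qed.

(** By [crossing_traces] a common neighbour would lie in [A], hence in both traces. *)
Lemma disjoint_traces_adj z z' : ~~ e v0 z -> ~~ e v0 z' ->
  [disjoint M z & M z'] -> e z z'.
Proof.
move=> zA z'A dis; apply/negPn/negP => zz'.
have [c1 c1M] := M_ex zA; have [c2 c2M] := M_ex z'A.
have c1N := disjointFr dis c1M; have c2N := disjointFl dis c2M.
have [q zq z'q] := e_common zz'.
have q0 := crossing_traces c1M c2M (negbT c1N) (negbT c2N) zq z'q.
have := disjointFr dis (x := q); rewrite !inM q0 zq z'q /=.
by move=> /(_ isT).
Qed.

(** If the traces cross, a common neighbour of [z], [z'] and [x] lies in [A], though it is adjacent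
    to [x] in [A]. *)
Lemma traces_nested z z' x : ~~ e z z' -> e v0 x -> ~~ e z x -> ~~ e z' x ->
  (M z \subset M z') || (M z' \subset M z).
Proof.
move=> zz' xA zx z'x.
case: (boolP (M z \subset M z')) => //= /subsetPn[c1 c1M c1N].
apply/negPn/negP => /subsetPn[c2 c2M c2N].
have [q [zq z'q xq]] := common_neighbour3 zz' z'x zx.
by have := A_nbr xA xq; rewrite (crossing_traces c1M c2M c1N c2N zq z'q).
Qed.

Lemma traces_disjointI z z' :
  (forall x, e v0 x -> e z x -> e z' x -> False) -> [disjoint M z & M z'].
Proof.
move=> dis; rewrite disjoint_subset; apply/subsetP => x.
rewrite inM => /andP[zx xA]; rewrite unfold_in /= inM xA andbT.
by apply/negP; apply: dis.
Qed.

Lemma trace_disjoint z z' : e z z' -> [disjoint M z & M z'].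
Proof. by move=> zz'; apply: traces_disjointI => x _ zx /(triangleF zz')/(_ zx). Qed.

(* When the vertices are placed on a circle, A is an arc, the traces are the
   initial and the final segments of A, and c lies at one end of A; then N c
   prolongs A at the opposite end, in the order of increasing traces. *)
Variables (z0 c : T).
Hypothesis z0A : ~~ e v0 z0.
Hypothesis z0_min : forall z, ~~ e v0 z -> #|M z0| <= #|M z|.
Hypothesis c_z0 : c \in M z0.

Let cA : e v0 c. Proof. by move: c_z0; rewrite inM => /andP[]. Qed.

Lemma Nc_notA z : e c z -> ~~ e v0 z. Proof. exact: A_nbr. Qed.

Lemma c_trace z : e c z -> c \in M z.
Proof. by rewrite inM cA e_sym => ->. Qed.

(** If not, [M z] and [M z0] cover [A]. For [c'] in [M z0] outside [M z], a common neighbour [q] of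
    [z] and [c'] has a trace inside [M z0] that misses [c], against minimality. *)
Lemma min_trace_sub z : e c z -> M z0 \subset M z.
Proof.
move=> cz; have zA := Nc_notA cz; have czM := c_trace cz.
have zz0 : ~~ e z z0.
  apply: (@common_neighbour_nonadj _ _ c); rewrite e_sym //.
  by move: c_z0; rewrite inM e_sym => /andP[].
apply/negPn/negP => sub; have /subsetPn[c' c'M c'N] := sub.
have c'A : e v0 c' by move: c'M; rewrite inM => /andP[].
have zc' : ~~ e z c' by move: c'N; rewrite inM c'A andbT.
have cover x : e v0 x -> e z x || e z0 x.
  move=> xA; apply/negPn/negP; rewrite negb_or => /andP[zx z0x].
  have /orP[sub'|] := traces_nested zz0 xA zx z0x; last by apply/negP.
  have /eqP eqM : M z == M z0 by rewrite eqEcard sub' z0_min.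
  by move: sub; rewrite eqM subxx.
have [q zq c'q] := e_common zc'; have qA := A_nbr c'A c'q.
have := z0_min qA; rewrite leqNgt => /negP; apply; apply: proper_card.
apply/properP; split; last first.
  exists c => //; rewrite inM cA andbT; apply/negP => qc.
  by apply: (triangleF zq qc); rewrite e_sym.
apply/subsetP => x; rewrite !inM => /andP[qx xA]; rewrite xA andbT.
case/orP: (cover _ xA) => // zx; case: (triangleF zq qx zx).
Qed.

(** If not, [M z] and [M z'] cover [A]. Take [q] adjacent to [z'] and [a1], and [q'] adjacent to [z]
    and [a2]: their traces avoid each other and [M z0], so [q], [q'], [z0] form a triangle. *)
Lemma traces_chain z z' : e c z -> e c z' ->
  (M z \subset M z') || (M z' \subset M z).
Proof.
move=> cz cz'; have zA := Nc_notA cz; have z'A := Nc_notA cz'.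
have zz' : ~~ e z z' by apply: (@common_neighbour_nonadj _ _ c); rewrite e_sym.
apply/negPn/negP => nest; have := nest; rewrite negb_or.
case/andP=> /subsetPn[a1 a1M a1N] /subsetPn[a2 a2M a2N].
have cover x : e v0 x -> e z x || e z' x.
  move=> xA; apply/negPn/negP; rewrite negb_or => /andP[zx z'x].
  by move: nest; rewrite (traces_nested zz' xA zx z'x).
move: a1M a2M a1N a2N; rewrite !inM.
move=> /andP[za1 a1A] /andP[z'a2 a2A]; rewrite a1A a2A !andbT => z'a1 za2.
have [q z'q a1q] := e_common z'a1; have [q' zq' a2q'] := e_common za2.
have qA := A_nbr a1A a1q; have q'A := A_nbr a2A a2q'.
have adj_z0 w y : e c y -> e y w -> ~~ e v0 w -> e w z0.
  move=> cy yw wA; apply: disjoint_traces_adj => //.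
  apply: disjointWr (min_trace_sub cy) _.
  by apply: trace_disjoint; rewrite e_sym.
have qz0 := adj_z0 _ _ cz' z'q qA; have q'z0 := adj_z0 _ _ cz zq' q'A.
suff qq' : e q q' by apply: (triangleF qq' q'z0 qz0).
apply: disjoint_traces_adj => //.
apply: traces_disjointI => x xA qx q'x.
case/orP: (cover _ xA) => [zx|z'x]; first by apply: (triangleF zq' q'x zx).
by apply: (triangleF z'q qx z'x).
Qed.

Lemma trace_sub_card z z' : e c z -> e c z' ->
  (M z \subset M z') = (#|M z| <= #|M z'|).
Proof.
move=> cz cz'; apply/idP/idP => [/subset_leq_card //|le].
by case/orP: (traces_chain cz cz') => // s; have /eqP -> : M z' == M z
  by rewrite eqEcard s.
Qed.

Definition below z := [set z' in N c | #|M z'| < #|M z|].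
Definition upto z := [set z' in N c | #|M z'| <= #|M z|].

(* In the circular picture, M z is a segment of A from c to u, and far u consists
   of the vertices that precede c and are not adjacent to u. *)
Definition fresh z u := (u \in M z) && [forall z' in below z, u \notin M z'].
Definition far u := [set z | [&& ~~ e v0 z, ~~ e c z & ~~ e u z]].

(** The traces form a chain, so it is enough to avoid the largest one below [z]; if there is none,
    [c] serves. *)
Lemma fresh_ex z : e c z -> exists u, fresh z u.
Proof.
move=> cz; case: (pickP (mem (below z))) => [z1 z1b | no]; last first.
  exists c; rewrite /fresh c_trace //=; apply/forall_inP => z'.
  by have /= -> := no z'.
case: (arg_maxnP (fun z' => #|M z'|) z1b) => z2 z2b z2max.
have /andP[cz2 lt2] : e c z2 && (#|M z2| < #|M z|) by move: z2b; rewrite !inE.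
have : ~~ (M z \subset M z2) by rewrite trace_sub_card // -ltnNge.
case/subsetPn => u uz uz2; exists u; rewrite /fresh uz /=.
apply/forall_inP => z' z'b; apply: contra uz2; apply/subsetP.
have /andP[cz' _] : e c z' && (#|M z'| < #|M z|) by move: z'b; rewrite !inE.
by rewrite trace_sub_card //; apply: z2max.
Qed.

(** A common neighbour [q] of [u], [c] and [z'] is not below [z], as [u] is fresh; so [M z] lies in
    [M q], which is disjoint from [M z']. *)
Lemma far_trace_disjoint z u z' : e c z -> fresh z u -> z' \in far u ->
  [disjoint M z & M z'].
Proof.
move=> cz /andP[uM /forall_inP ub]; rewrite inE => /and3P[z'A cz' uz'].
have uA : e v0 u by move: uM; rewrite inM => /andP[].
have [q [uq cq z'q]] := common_neighbour3 (A_indep uA cA) cz' uz'.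
apply: disjointWl (trace_disjoint (z := q) _); last by rewrite e_sym.
rewrite trace_sub_card // leqNgt; apply/negP => lt.
have : q \in below z by rewrite !inE cq.
by move/ub; rewrite inM uA e_sym uq.
Qed.

Lemma far_adj z u z' : e c z -> fresh z u -> z' \in far u -> e z z'.
Proof.
move=> cz fu z'f; apply: disjoint_traces_adj (Nc_notA cz) _ _.
  by move: z'f; rewrite inE => /andP[].
exact: far_trace_disjoint fu z'f.
Qed.

(** A neighbour of [c] not adjacent to [u] has a trace missing [u], so by the chain property it is
    below [z]. *)
Lemma cover_far z u : e c z -> fresh z u ->
  #|T| <= #|A| + #|N u| + #|below z| + #|far u|.
Proof.
move=> cz /andP[uM ub].
have uA : e v0 u by move: uM; rewrite inM => /andP[].
suff -> : #|T| = #|A :|: N u :|: below z :|: far u|.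
  do 3 (apply: leq_trans (leq_card_setU _ _) _; rewrite leq_add2r).
  exact: leqnn.
rewrite -cardsT; congr #|pred_of_set _|; apply/esym/eqP.
rewrite -subTset; apply/subsetP => w _; rewrite !inE.
case: (boolP (e v0 w)) => //= wA; case: (boolP (e u w)) => //= uw.
case: (boolP (e c w)) => //= cw; rewrite orbF ltnNge -trace_sub_card //.
apply/negP => /subsetP/(_ _ uM); rewrite inM e_sym.
by rewrite (negbTE uw).
Qed.

(** * Trace sizes from degree counts *)

Hypothesis v0_max : forall x, #|N x| <= #|N v0|.

(** The disjoint sets [far u] and [M z] both lie in [N z]; combine this with [cover_far] and the
    maximality of [A]. *)
Lemma card_trace_below z : e c z -> #|T| + #|M z| <= 3 * #|A| + #|below z|.
Proof.
move=> cz; have [u fu] := fresh_ex cz; have := cover_far cz fu.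
have := v0_max u; have := v0_max z; rewrite -/A.
suff : #|far u| + #|M z| <= #|N z| by clear; lia.
have <- : #|far u :|: M z| = #|far u| + #|M z|.
  apply/eqP; rewrite (leq_card_setU (far u) (M z)).2.
  rewrite disjoint_sym disjoint_subset; apply/subsetP => x.
  by rewrite inM => /andP[_ xA]; rewrite unfold_in /= inE xA.
apply: subset_leq_card; apply/subsetP => x; rewrite in_setU [x \in N z]inE.
by case/orP=> [xf|]; [apply: far_adj xf | rewrite inM => /andP[]].
Qed.

Variable d : nat.
Hypothesis e_deg : forall x, d <= #|N x|.

(** If [M z] is not all of [A], some neighbour [y] of [z] has trace exactly [A :\: M z], and its
    neighbours outside [A] all belong to [upto z]. *)
Lemma card_trace_upto z : e c z -> #|M z| + d <= #|A| + #|upto z|.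
Proof.
move=> cz; have zA := Nc_notA cz.
have sMA y : M y \subset A by apply: subsetIr.
case: (boolP (A \subset M z)) => [sAM | /subsetPn[a4 a4A a4M]].
  have -> : M z = A by apply/eqP; rewrite eqEsubset sMA.
  rewrite leq_add2l; apply: leq_trans (e_deg c) _.
  apply: subset_leq_card; apply/subsetP => w; rewrite !inE => cw.
  by rewrite cw /= subset_leq_card // (subset_trans (sMA _) sAM).
move: a4A a4M; rewrite inE => a4A; rewrite inM a4A andbT => za4.
have [y0 zy0 a4y0] := e_common za4; have y0A := A_nbr a4A a4y0.
have y0P : [pred y | e z y && ~~ e v0 y] y0 by rewrite /= zy0.
case: (arg_maxnP (fun y => #|M y|) y0P) => y /andP[zy yA] ymax.
have dis_zy := trace_disjoint zy.
(* Otherwise [z] and [x] have a common neighbour [y']. Neither [y] nor [y'] sees [b], so their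
   traces are nested, and the one of [y'] is larger because of [x]. *)
have yM x : e v0 x -> ~~ e z x -> e y x.
  move=> xA zx; apply/negPn/negP => yx.
  have [a5 a5M] := M_ex yA; have := a5M; rewrite inM => /andP[ya5 a5A].
  have za5 : ~~ e z a5.
    by apply: (@common_neighbour_nonadj _ _ y) => //; rewrite e_sym.
  have [y' [zy' xy' a5y']] := common_neighbour3 zx (A_indep xA a5A) za5.
  have y'A := A_nbr xA xy'.
  have yy' : ~~ e y y'.
    by apply: (@common_neighbour_nonadj _ _ z); rewrite e_sym.
  have [b /[!inM]/andP[zb bA]] := M_ex zA.
  have nb t : e z t -> ~~ e t b.
    by move=> zt; apply/negP => tb; apply: (triangleF zt tb zb).
  have xM' : x \in M y' by rewrite inM xA e_sym xy'.
  have xM : x \notin M y by rewrite inM xA andbT.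
  have /orP[s|/subsetP/(_ x xM')] := traces_nested yy' bA (nb _ zy) (nb _ zy').
    have := ymax y'; rewrite /= zy' y'A => /(_ isT); apply/negP.
    rewrite -ltnNge; apply: proper_card; apply/properP; split=> //.
    by exists x.
  exact/negP.
have sNy : N y \subset (A :\: M z) :|: upto z.
  apply/subsetP => w; rewrite inE => yw; rewrite in_setU in_setD.
  case: (boolP (e v0 w)) => wA.
    apply/orP; left; rewrite inM wA andbT [w \in A]inE wA andbT.
    by apply/negP => zw; apply: (triangleF zy yw zw).
  have sw : M w \subset M z.
    apply/subsetP => x; rewrite !inM => /andP[wx xA]; rewrite xA andbT.
    apply/negPn/negP => zx; apply: (triangleF yw wx); exact: yM.
  apply/orP; right; rewrite !inE (subset_leq_card sw) andbT.
  (* If [w] is not adjacent to [c], either [y], [w], [z0] form a triangle or [M w] is comparable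
     with the minimal trace while missing [c]. *)
  apply/negPn/negP => cw; have cwM : c \notin M w by rewrite inM e_sym (negbTE cw).
  case: (boolP (e w z0)) => wz0.
    apply: (triangleF yw wz0); apply: disjoint_traces_adj => //.
    by rewrite disjoint_sym (disjointWl (min_trace_sub cz)).
  have na4 t : M t \subset M z -> ~~ e t a4.
    move/subsetP/(_ a4); rewrite !inM a4A !andbT (negbTE za4) => ta4.
    by apply/negP => /ta4.
  have /orP[s|/subsetP/(_ c c_z0)] :=
    traces_nested wz0 a4A (na4 _ sw) (na4 _ (min_trace_sub cz)); last exact/negP.
  have /eqP eqM : M w == M z0 by rewrite eqEcard s z0_min.
  by move: cwM; rewrite eqM c_z0.
have := leq_trans (subset_leq_card sNy) (leq_card_setU _ _).
have := e_deg y; rewrite cardsD (setIidPr (sMA z)).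
have := subset_leq_card (sMA z); clear; lia.
Qed.

Lemma below_sub x z : e c z -> x \in below z ->
  [/\ e c x, below x \subset below z & upto x \subset below z].
Proof.
rewrite !inE => cz /andP[cx lt]; split=> //; apply/subsetP => y;
  rewrite !inE => /andP[-> /=]; move: lt; clear; lia.
Qed.

(** Add both trace bounds for each [x]; by [sum_comparisons] the sizes of [below x] and [upto x] sum
    to the square of that of [below z]. *)
Lemma sum_trace_below z : e c z ->
  2 * (\sum_(x in below z) #|M x|) + #|below z| * (#|T| + d) <=
  4 * #|A| * #|below z| + #|below z| * #|below z|.
Proof.
move=> cz; set B := below z.
have le_x x : x \in B -> 2 * #|M x| + (#|T| + d) <=
    4 * #|A| + \sum_(y in B) ((#|M y| < #|M x|) + (#|M y| <= #|M x|)).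
  move=> /(below_sub cz)[cx sb su].
  have := card_trace_below cx; have := card_trace_upto cx.
  have -> : \sum_(y in B) ((#|M y| < #|M x|) + (#|M y| <= #|M x|)) =
      #|below x| + #|upto x|.
    rewrite big_split /= !sum_nat_of_bool; congr (_ + _); apply: eq_card => y.
      rewrite inE; apply/andP/idP => [[yB yx]|yx].
        by move: yB; rewrite !inE yx => /andP[->].
      by rewrite (subsetP sb) //; move: yx; rewrite inE => /andP[].
    rewrite inE; apply/andP/idP => [[yB yx]|yx].
      by move: yB; rewrite !inE yx => /andP[->].
    by rewrite (subsetP su) //; move: yx; rewrite inE => /andP[].
  clear; lia.
have : \sum_(x in B) (2 * #|M x| + (#|T| + d)) <= \sum_(x in B) (4 * #|A| +
    \sum_(y in B) ((#|M y| < #|M x|) + (#|M y| <= #|M x|))) by exact: leq_sum.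
rewrite big_split [leqRHS]big_split /= -big_distrr /= sum_comparisons.
rewrite !sum_nat_const.
by rewrite [#|B| * (4 * _)]mulnC.
Qed.

Lemma trace_sum_below_upto z : e c z ->
  \sum_(x in below z) #|M x| + #|below z| * d <=
  #|below z| * (#|A| + #|below z|).
Proof.
move=> cz; rewrite -!sum_nat_const -big_split /=.
apply: leq_sum => x /(below_sub cz)[cx _ /subset_leq_card le].
by apply: leq_trans (card_trace_upto cx) _; rewrite leq_add2l.
Qed.

(** * Choosing the sparse half *)

Hypothesis d_large : #|T| <= 3 * d.

Definition independent (B : {set T}) := {in B &, forall x y, ~~ e x y}.

Lemma N_indep x : independent (N x).
Proof.
by move=> y z; rewrite !inE => xy xz; apply: (@common_neighbour_nonadj _ _ x);
  rewrite e_sym.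
Qed.

Lemma sparse_half_extending_max h : 2 * (h + #|A|) <= #|T| ->
  exists2 D : {set T}, [/\ independent D, [disjoint A & D] & #|D| = h] &
    50 * (\sum_(z in D) #|M z|) <= #|T| * #|T|.
Proof.
case: (posnP h) => [-> _|h0 hA].
  exists set0; last by rewrite big_set0.
  by split; [move=> x y; rewrite inE | rewrite -setI_eq0 setI0 | rewrite cards0].
have dA : d <= #|A| := e_deg v0.
have hN : h <= #|N c|.
  by apply: leq_trans (e_deg c); move: hA dA d_large; clear; lia.
have [D [sDN cD] minD] := initial_subset (fun z => #|M z|) hN.
have [x0 x0D] : exists x, x \in D by apply/card_gt0P; rewrite cD.
case: (@arg_maxnP _ x0 [in D] (fun z => #|M z|) x0D) => z zD maxz.
have cz : e c z by have := subsetP sDN z zD; rewrite inE.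
have sbD : below z \subset D.
  apply/subsetP => x; rewrite !inE => /andP[cx lt].
  apply: contraLR lt => xD; rewrite -leqNgt; apply: minD => //.
  by rewrite !inE xD.
have disAD (B : {set T}) : (forall x, x \in B -> ~~ e v0 x) -> [disjoint A & B].
  move=> BA; rewrite disjoint_sym disjoint_subset; apply/subsetP => x /BA.
  by rewrite unfold_in /= inE.
have ltb : #|below z| < h.
  rewrite -cD; apply: proper_card; apply/properP; split=> //.
  by exists z => //; rewrite !inE ltnn andbF.
have DP : [/\ independent D, [disjoint A & D] & #|D| = h].
  split=> //.
    by move=> x y xD yD; apply: (N_indep (subsetP sDN x xD) (subsetP sDN y yD)).
  by apply: disAD => x /(subsetP sDN); rewrite inE; apply: Nc_notA.
(* Outside [below z] every trace in [D] has the maximal size [#|M z|]. *)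
have sumD : \sum_(x in D) #|M x| =
    \sum_(x in below z) #|M x| + (h - #|below z|) * #|M z|.
  rewrite (big_setID (below z)) (setIidPr sbD) /=; congr (_ + _).
  rewrite -cD -(cardsDS sbD) -sum_nat_const; apply: eq_bigr => x.
  rewrite in_setD => /andP[xb xD]; apply/eqP; rewrite eqn_leq.
  apply/andP; split; first exact: maxz.
  have cx : e c x by have := subsetP sDN x xD; rewrite inE.
  by move: xb; rewrite !inE cx /= -leqNgt.
case: (leqP (5 * #|A|) (2 * #|T|)) => A5.
  exists D => //; rewrite sumD.
  apply: (@staircase_bound_nat #|T| d #|A|) => //.
  - exact: ltnW.
  - by move: dA d_large; clear; lia.
  - by rewrite addnC; exact: card_trace_below.
  - exact: sum_trace_below.
  - exact: trace_sum_below_upto.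
(* The other side of [A] is [far u]: it has at least [h] vertices, all adjacent to [z], and their
   traces avoid [M z]. *)
have [u fu] := fresh_ex cz.
have [D' sD' cD'] : exists2 D' : {set T}, D' \subset far u & #|D'| = h.
  have /(initial_subset (fun=> 0))[D' [? ?] _] : h <= #|far u|; last by exists D'.
  have := cover_far cz fu; have := v0_max u; move: ltb hA; rewrite -/A.
  by clear; lia.
have sumD' : \sum_(x in D') #|M x| <= h * (#|A| - #|M z|).
  rewrite -cD' -sum_nat_const; apply: leq_sum => x /(subsetP sD') xf.
  have sMA y : M y \subset A by apply: subsetIr.
  rewrite -(cardsDS (sMA z)); apply: subset_leq_card.
  by rewrite subsetD sMA disjoint_sym (far_trace_disjoint cz fu xf).
have sumDle : \sum_(x in D) #|M x| <= h * #|M z|.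
  by rewrite -cD -sum_nat_const; apply: leq_sum => x xD; apply: maxz.
(* For a > 2n/5, (n/2 - a) a/2 is below its value n^2/50 at a = 2n/5. *)
have half m : 2 * m <= #|A| -> 50 * (h * m) <= #|T| * #|T|.
  by move: hA A5; move: #|A| #|T|; clear; nia.
case: (leqP (2 * #|M z|) #|A|) => M2.
  by exists D => //; apply: leq_trans (half _ M2); rewrite leq_mul2l sumDle orbT.
exists D'; last first.
  apply: leq_trans (half (#|A| - #|M z|) _); first by rewrite leq_mul2l sumD' orbT.
  by move: M2; clear; lia.
split=> // [x y /(subsetP sD') xf /(subsetP sD') yf|].
  by apply: (@N_indep z); rewrite inE (far_adj cz fu).
by apply: disAD => x /(subsetP sD'); rewrite inE => /andP[].
Qed.

End HexagonFree.

(** * Edge-maximal graphs *)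

Definition edges_within (T : finType) (e : rel T) (S : {set T}) : {set {set T}} :=
  [set E in [set [set p.1; p.2] | p : T * T & e p.1 p.2] | E \subset S].

Lemma edges_within_sub (T : finType) (e e' : rel T) (S : {set T}) :
  subrel e e' -> edges_within e S \subset edges_within e' S.
Proof.
move=> ee'; apply/subsetP => E; rewrite !inE => /andP[/imsetP[p pe ->] ->].
by rewrite andbT; apply/imsetP; exists p => //; move: pe; rewrite !inE; apply: ee'.
Qed.

Lemma card_edges_within (T : finType) (e : rel T) (A D : {set T}) :
  symmetric e -> independent e A -> independent e D ->
  #|edges_within e (A :|: D)| <= \sum_(z in D) #|[set y | e z y] :&: A|.
Proof.
move=> e_sym iA iD.
pose F z := [set [set z; y] | y in [set y | e z y] :&: A].
have : edges_within e (A :|: D) \subset \bigcup_(z in D) F z.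
  apply/subsetP => E; rewrite inE => /andP[/imsetP[[x y]]].
  rewrite inE /= => xy -> /subsetP sub.
  have: x \in A :|: D by apply: sub; rewrite !inE eqxx.
  have: y \in A :|: D by apply: sub; rewrite !inE eqxx orbT.
  have wit a z : a \in A -> z \in D -> e z a ->
      [set z; a] \in \bigcup_(z in D) F z.
    by move=> aA zD za; apply/bigcupP; exists z => //; apply: imset_f; rewrite !inE za.
  rewrite !inE => /orP[yA|yD] /orP[xA|xD].
  - by have := iA x y xA yA; rewrite xy.
  - exact: wit.
  - by rewrite setUC; apply: wit; rewrite // e_sym.
  - by have := iD x y xD yD; rewrite xy.
move/subset_leq_card/leq_trans; apply.
elim/big_ind2: _ => [|m1 m2 B1 B2 le1 le2|z _]; first by rewrite cards0.
  exact: leq_trans (leq_card_setU _ _) (leq_add le1 le2).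
exact: leq_imset_card.
Qed.

Lemma sparse_half (T : finType) (e : rel T) (d : nat) :
  symmetric e -> (forall x y z, ~~ [&& e x y, e y z & e x z]) ->
  (forall x y, ~~ e x y -> exists2 z, e x z & e y z) ->
  (forall v1 v2 v3 v4 v5 v6,
    [&& e v1 v2, e v2 v3, e v3 v4, e v4 v5, e v5 v6 & e v6 v1] ->
    [|| e v1 v4, e v2 v5 | e v3 v6]) ->
  (forall x, d <= #|[set y | e x y]|) -> #|T| <= 3 * d ->
  exists2 S : {set T}, #|S| = #|T|./2 & 50 * #|edges_within e S| <= #|T| * #|T|.
Proof.
move=> e_sym e_tf e_common e_no_hexagon e_deg d_large.
case: (pickP (mem T)) => [x0 _|T0]; last first.
  have T00 : #|T| = 0 by apply: eq_card0.
  exists set0; rewrite ?cards0 ?T00 //.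
  by rewrite leqn0 muln_eq0 /= -leqn0 -(cards0 {set T}); apply: subset_leq_card;
    apply/subsetP => E; rewrite inE => /andP[/imsetP[p]]; have := T0 p.1.
pose N x := [set y | e x y].
case: (@arg_maxnP _ x0 predT (fun x => #|N x|) isT) => v _ vmax.
have sparse (A D : {set T}) :
    independent e A -> independent e D -> [disjoint A & D] ->
    #|A| + #|D| = #|T|./2 -> 50 * (\sum_(z in D) #|N z :&: A|) <= #|T| * #|T| ->
    exists2 S : {set T}, #|S| = #|T|./2 &
      50 * #|edges_within e S| <= #|T| * #|T|.
  move=> iA iD dis card le; exists (A :|: D).
    by rewrite -card; apply/eqP; rewrite (leq_card_setU A D).2.
  by apply: leq_trans le; rewrite leq_mul2l card_edges_within.
have iN : independent e (N v) by apply: N_indep.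
case: (leqP #|T|./2 #|N v|) => [leN|ltN].
  have [A [sAN cA] _] := initial_subset (fun=> 0) leN.
  apply: (sparse A set0).
  - by move=> x y /(subsetP sAN) xN /(subsetP sAN); apply: iN.
  - by move=> x y; rewrite inE.
  - by rewrite -setI_eq0 setI0.
  - by rewrite cards0 addn0.
  - by rewrite big_set0 muln0.
have vv : ~~ e v v by apply: irrefl.
case: (@arg_minnP _ v [pred z | ~~ e v z] (fun z => #|N z :&: N v|) vv)
  => z0 /= z0A z0min.
have [c cz0] : exists c, c \in N z0 :&: N v.
  by have [c vc z0c] := e_common _ _ z0A; exists c; rewrite !inE vc z0c.
have [|D [iD dis cD] leD] := @sparse_half_extending_max T e e_sym e_tf
  e_common e_no_hexagon v z0 c z0A z0min cz0 (fun x => vmax x isT) d e_deg d_large (#|T|./2 - #|N v|).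
  by rewrite subnK ?(ltnW ltN) // mul2n -geq_half_double.
by apply: sparse leD => //; rewrite cD subnKC // ltnW.
Qed.

(** [Q] is trivial for (a) and 3-colourability for (b). Relations become sets of ordered pairs so
    that a maximal one can be chosen. *)
Lemma maximal_triangle_free (T : finType) (e : rel T) (Q : pred {set T * T}) :
  symmetric e -> (forall x y z, ~~ [&& e x y, e y z & e x z]) ->
  Q [set p | e p.1 p.2] ->
  exists e' : rel T, [/\ subrel e e', symmetric e',
    forall x y z, ~~ [&& e' x y, e' y z & e' x z], Q [set p | e' p.1 p.2] &
    forall x y, x != y -> ~~ e' x y -> (exists2 z, e' x z & e' y z) \/
      ~~ Q ((x, y) |: ((y, x) |: [set p | e' p.1 p.2]))].
Proof.
move=> e_sym e_tf Qe.
pose P (E : {set T * T}) := [&& Q E,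
  [forall x, forall y, ((x, y) \in E) == ((y, x) \in E)] &
  [forall x, forall y, forall z,
     ~~ [&& (x, y) \in E, (y, z) \in E & (x, z) \in E]]].
have PE (E : {set T * T}) : reflect [/\ Q E,
    forall x y, ((x, y) \in E) = ((y, x) \in E) &
    forall x y z, (x, y) \in E -> (y, z) \in E -> (x, z) \in E -> False] (P E).
  apply: (iffP and3P) => -[QE symE tfE]; split=> //.
  - by move=> x y; apply/eqP; move/forallP/(_ x)/forallP: symE.
  - move=> x y z xy yz xz; move/forallP/(_ x)/forallP/(_ y)/forallP/(_ z): tfE.
    by rewrite xy yz xz.
  - by apply/forallP => x; apply/forallP => y; rewrite symE.
  - apply/forallP => x; apply/forallP => y; apply/forallP => z.
    by apply/negP => /and3P[xy yz xz]; apply: tfE xy yz xz.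
have [|E maxE sE] := @maxset_exists _ P [set p | e p.1 p.2].
  apply/PE; split=> // [x y|x y z]; rewrite !inE //=.
  by move=> xy yz xz; have := e_tf x y z; rewrite xy yz xz.
have /maxsetP[/PE[QE symE tfE] maxP] := maxE.
have EE : [set p | (p.1, p.2) \in E] = E by apply/setP => -[x y]; rewrite inE.
exists (fun x y => (x, y) \in E); split.
- by move=> x y xy; apply: (subsetP sE); rewrite inE.
- exact: symE.
- by move=> x y z; apply/negP => /and3P[]; apply: tfE.
- by rewrite EE.
move=> x y xy xyE; rewrite EE.
case: (pickP (fun z => ((x, z) \in E) && ((y, z) \in E))).
  by move=> z /andP[xz yz]; left; exists z.
move=> no; right; apply/negP => Q'.
set E' := _ |: _ in Q'.
suff /maxP/(_ _) E'E : P E'.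
  by move: xyE; rewrite -E'E ?setU11 // /E' setUA subsetUr.
have inE' a b : ((a, b) \in E') =
    [|| (a == x) && (b == y), (a == y) && (b == x) | (a, b) \in E].
  by rewrite !inE !xpair_eqE.
have irr a : (a, a) \in E -> False by move=> aa; exact: (tfE _ _ _ aa aa aa).
have nc z : (x, z) \in E -> (y, z) \in E -> False.
  by move=> xz yz; have := no z; rewrite xz yz.
have sy a b : (a, b) \in E -> (b, a) \in E by rewrite symE.
have yx : y == x = false by apply/negbTE; rewrite eq_sym.
apply/PE; split=> // [a b|a b f].
  rewrite !inE' symE.
  by case: (a == x); case: (b == y); case: (a == y); case: (b == x).
have new u v : (u, v) \in E' ->
    [\/ u = x /\ v = y, u = y /\ v = x | (u, v) \in E].
  by rewrite inE' => /or3P[/andP[/eqP-> /eqP->]|/andP[/eqP-> /eqP->]|];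
    [apply: Or31 | apply: Or32 | apply: Or33].
have xyN : x <> y by apply/eqP.
case/new=> [[? ?]|[? ?]|ab]; case/new=> [[? ?]|[? ?]|bf];
  case/new=> [[? ?]|[? ?]|af]; subst; solve [congruence | eauto].
Qed.

Lemma subrel_degree (T : finType) (e e' : rel T) d : subrel e e' ->
  (forall x, d <= #|[set y | e x y]|) -> forall x, d <= #|[set y | e' x y]|.
Proof.
move=> ee' e_deg x; apply: leq_trans (e_deg x) _; apply: subset_leq_card.
by apply/subsetP => y; rewrite !inE; apply: ee'.
Qed.

Lemma sparse_half_sub (T : finType) (e e' : rel T) (n : nat) : subrel e e' ->
  (exists2 S : {set T}, #|S| = #|T|./2 & 50 * #|edges_within e' S| <= n) ->
  exists2 S : {set T}, #|S| = #|T|./2 & 50 * #|edges_within e S| <= n.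
Proof.
move=> ee' [S cS le]; exists S => //; apply: leq_trans le.
by rewrite leq_mul2l subset_leq_card ?edges_within_sub ?orbT.
Qed.

Lemma degree_gt0 (T : finType) (e : rel T) d x : #|T| < 3 * d ->
  (forall x, d <= #|[set y | e x y]|) -> exists y, e x y.
Proof.
move=> dT e_deg; have : 0 < #|[set y | e x y]|.
  by apply: leq_trans (e_deg x); move: dT; clear; lia.
by case/card_gt0P=> y; rewrite inE; exists y.
Qed.

Lemma sparse_half_10_29 (T : finType) (e : rel T) (d : nat) :
  symmetric e -> (forall x y z, ~~ [&& e x y, e y z & e x z]) ->
  (forall x, d <= #|[set y | e x y]|) -> 10 * #|T| < 29 * d ->
  exists2 S : {set T}, #|S| = #|T|./2 & 50 * #|edges_within e S| <= #|T| * #|T|.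
Proof.
move=> e_sym e_tf e_deg dT; have dT3 := ltn_3_of_10_29 dT.
have [e' [ee' s' t' _ max']] := @maximal_triangle_free T e predT e_sym e_tf isT.
have deg' := subrel_degree ee' e_deg.
have cn x y : ~~ e' x y -> exists2 z, e' x z & e' y z.
  case: (eqVneq x y) => [<- _|xy /(max' _ _ xy)[]//].
  by have [z xz] := degree_gt0 x dT3 deg'; exists z.
apply: sparse_half_sub ee' _; apply: (@sparse_half T e' d) => //; last exact: ltnW.
move=> v1 v2 v3 v4 v5 v6 hex; apply/negPn/negP; rewrite !negb_or.
case/and3P=> /cn[a a1 a4] /cn[b b2 b5] /cn[c c3 c6].
apply: (no_chorded_hexagon s' t' deg' (a := a) (b := b) (c := c) dT hex).
by rewrite !(s' _ v1) !(s' _ v2) !(s' _ v3) !(s' _ v4) !(s' _ v5) !(s' _ v6);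
  apply/and5P; split=> //; apply/andP.
Qed.

Lemma three_colours (a b c w : 'I_3) :
  a != b -> b != c -> a != c -> w != a -> w != b -> w == c.
Proof.
rewrite -!val_eqE /=; move: (ltn_ord a) (ltn_ord b) (ltn_ord c) (ltn_ord w).
by move: (val a) (val b) (val c) (val w) => {}a {}b {}c {}w; clear; lia.
Qed.

(** * 3-coloured graphs *)

Section ThreeColoured.

Variables (T : finType) (e : rel T) (d : nat).
Hypothesis e_sym : symmetric e.
Hypothesis e_tf : forall x y z, ~~ [&& e x y, e y z & e x z].
Hypothesis e_deg : forall x, d <= #|[set y | e x y]|.
Hypothesis dT : #|T| < 3 * d.
Variable f : T -> 'I_3.
Hypothesis f_col : forall x y, e x y -> f x != f y.

(** The vertex forced by [hexagon] would see all three colours. *)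
Lemma no_rainbow_hexagon v1 v2 v3 v4 v5 v6 :
  [&& e v1 v2, e v2 v3, e v3 v4, e v4 v5, e v5 v6 & e v6 v1] ->
  f v1 != f v3 -> f v3 != f v5 -> f v1 != f v5 ->
  f v2 != f v4 -> f v4 != f v6 -> f v2 != f v6 -> False.
Proof.
move=> /and5P[e12 e23 e34 e45 /andP[e56 e61]] c13 c35 c15 c24 c46 c26.
have [w /orP[]/and3P[w1 w2 w3]] :=
  hexagon e_sym e_tf e_deg dT e12 e23 e34 e45 e56 e61.
  by have := three_colours c13 c35 c15 (f_col w1) (f_col w2); apply/negP/f_col.
by have := three_colours c24 c46 c26 (f_col w1) (f_col w2); apply/negP/f_col.
Qed.

Hypothesis f_common : forall x y,
  f x != f y -> ~~ e x y -> exists2 z, e x z & e y z.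

(** Common neighbours of [x], [y'] and of [x'], [y] both get the third colour and close a hexagon
    coloured 123123. *)
Lemma no_induced_2K2 x y x' y' : e x y -> e x' y' -> f x = f x' -> f y = f y' ->
  e x y' || e x' y.
Proof.
move=> xy x'y' fx fy; apply/negPn/negP; rewrite negb_or => /andP[xy' x'y].
have fxy := f_col xy.
have [||z xz y'z] := @f_common x y' => //; first by rewrite -fy.
have [||z' x'z' yz'] := @f_common x' y => //; first by rewrite -fx.
have fxz := f_col xz; have fyz := f_col y'z; rewrite -fy in fyz.
have fyz' := f_col yz'; have fxz' := f_col x'z'; rewrite -fx in fxz'.
have fz : f z = f z' by apply/eqP/(three_colours fxy fyz' fxz'); rewrite eq_sym.
apply: (@no_rainbow_hexagon x y z' x' y' z); rewrite -?fz -?fy -?fx //.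
- by rewrite xy yz' (e_sym z') x'z' x'y' y'z e_sym xz.
- by rewrite eq_sym.
- by rewrite eq_sym.
Qed.

End ThreeColoured.

(** Two opposite edges join the same colour classes, matched by a half turn in the first three cases
    and by a reflection in the others. *)
Lemma hexagon_colouring (c1 c2 c3 c4 c5 c6 : 'I_3) :
  [&& c1 != c2, c2 != c3, c3 != c4, c4 != c5, c5 != c6 & c6 != c1] ->
  [|| [|| (c1 == c4) && (c2 == c5), (c2 == c5) && (c3 == c6) |
          (c3 == c6) && (c4 == c1)],
      (c1 == c5) && (c2 == c4), (c2 == c6) && (c3 == c5) |
      (c3 == c1) && (c4 == c6)].
Proof.
case: c1 c2 c3 c4 c5 c6 => [[|[|[|?]]] ?] [[|[|[|?]]] ?] [[|[|[|?]]] ?] //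
  [[|[|[|?]]] ?] // [[|[|[|?]]] ?] // [[|[|[|?]]] ?] //.
Qed.

Definition three_colourable (T : finType) : pred {set T * T} := fun E =>
  [exists f : {ffun T -> 'I_3},
     [forall x, forall y, ((x, y) \in E) ==> (f x != f y)]].

Lemma three_colourableP (T : finType) (E : {set T * T}) :
  reflect (exists f : T -> 'I_3, forall x y, (x, y) \in E -> f x != f y)
    (three_colourable E).
Proof.
apply: (iffP existsP) => -[f fE].
  by exists f => x y; apply/implyP; move/forallP/(_ x)/forallP: fE.
exists (finfun f); apply/forallP => x; apply/forallP => y; apply/implyP.
by rewrite !ffunE; apply: fE.
Qed.

Lemma sparse_half_3col (T : finType) (e : rel T) (d : nat) :
  symmetric e -> (forall x y z, ~~ [&& e x y, e y z & e x z]) ->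
  (forall x, d <= #|[set y | e x y]|) -> #|T| < 3 * d ->
  (exists f : T -> 'I_3, forall x y, e x y -> f x != f y) ->
  exists2 S : {set T}, #|S| = #|T|./2 & 50 * #|edges_within e S| <= #|T| * #|T|.
Proof.
move=> e_sym e_tf e_deg dT [f0 f0_col].
have [|e' [ee' s' t' /three_colourableP[f f_col'] max']] :=
  @maximal_triangle_free T e (@three_colourable T) e_sym e_tf.
  by apply/three_colourableP; exists f0 => x y; rewrite inE; apply: f0_col.
have f_col x y : e' x y -> f x != f y by move=> xy; apply: f_col'; rewrite inE.
have deg' := subrel_degree ee' e_deg.
have add_edge (g : T -> 'I_3) x y :
    (forall u v, e' u v -> g u != g v) -> g x != g y ->
    three_colourable ((x, y) |: ((y, x) |: [set p | e' p.1 p.2])).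
  move=> g_col gxy; apply/three_colourableP; exists g => u v.
  rewrite !inE !xpair_eqE => /or3P[/andP[/eqP-> /eqP->]//|/andP[/eqP-> /eqP->]|].
    by rewrite eq_sym.
  exact: g_col.
have f_common x y : f x != f y -> ~~ e' x y -> exists2 z, e' x z & e' y z.
  move=> fxy nxy; have xy : x != y by apply: contraNneq fxy => ->.
  by have [//|] := max' x y xy nxy; rewrite (add_edge f).
have K22 := no_induced_2K2 s' t' deg' dT f_col f_common.
have cn x y : ~~ e' x y -> exists2 z, e' x z & e' y z.
  move=> nxy; case: (eqVneq x y) => [<-|xy].
    by have [z xz] := degree_gt0 x dT deg'; exists z.
  case: (eqVneq (f x) (f y)) => [fxy|/f_common]; last exact.
  have [//|NQ] := max' x y xy nxy.
  have [j jx] : exists j : 'I_3, j != f x.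
    case: (eqVneq (f x) ord0) => [->|?]; first by exists ord_max.
    by exists ord0; rewrite eq_sym.
  (* If no neighbour of [u] had colour [j], recolouring [u] with [j] would allow the edge [u v]. *)
  have colour_nbr u v : u != v -> f u != j -> f u = f v ->
      ~~ three_colourable ((u, v) |: ((v, u) |: [set p | e' p.1 p.2])) ->
      exists2 z, e' u z & f z = j.
    move=> uv uj fuv.
    case: (pickP (fun z => e' u z && (f z == j))) => [z /andP[uz /eqP fz] _|no].
      by exists z.
    rewrite (add_edge (fun z => if z == u then j else f z)) //.
    - have jN z : e' u z -> f z != j by move=> uz; have := no z; rewrite uz /= => ->.
      move=> a b ab; case: (eqVneq a u) => [au|_]; case: (eqVneq b u) => [bu|_].
      + by rewrite au bu in ab; have := t' u u u; rewrite ab.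
      + by rewrite eq_sym jN // -au.
      + by rewrite jN // s' -bu.
      + exact: f_col.
    - by rewrite eqxx [v == u]eq_sym (negbTE uv) -fuv eq_sym.
  have [|z xz fz] := colour_nbr x y xy _ fxy NQ; first by rewrite eq_sym.
  have [||||z' yz' fz'] := colour_nbr y x.
  - by rewrite eq_sym.
  - by rewrite -fxy eq_sym.
  - by [].
  - by rewrite setUCA.
  have /orP[xz'|yz] := K22 x z y z' xz yz' fxy (etrans fz (esym fz')).
    by exists z'.
  by exists z.
apply: sparse_half_sub ee' _; apply: (@sparse_half T e' d) => //; last exact: ltnW.
move=> v1 v2 v3 v4 v5 v6 /and5P[e12 e23 e34 e45 /andP[e56 e61]].
have dist2 x y z : e' x y -> e' y z -> e' x z = false.
  by move=> xy yz; apply/negbTE; have := t' x y z; rewrite xy yz.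
have hexc : [&& f v1 != f v2, f v2 != f v3, f v3 != f v4, f v4 != f v5,
    f v5 != f v6 & f v6 != f v1].
  by rewrite (f_col _ _ e12) (f_col _ _ e23) (f_col _ _ e34) (f_col _ _ e45)
    (f_col _ _ e56) (f_col _ _ e61).
(* A half turn would give a chord at distance two, closing a triangle; a reflection gives a long
   diagonal. *)
have /or4P[/or3P[]|/andP[/eqP c15 /eqP c24]||] := hexagon_colouring hexc.
- move=> /andP[/eqP c14 /eqP c25]; have := K22 _ _ _ _ e12 e45 c14 c25.
  by rewrite s' (dist2 _ _ _ e56 e61) s' (dist2 _ _ _ e23 e34).
- move=> /andP[/eqP c25 /eqP c36]; have := K22 _ _ _ _ e23 e56 c25 c36.
  by rewrite s' (dist2 _ _ _ e61 e12) s' (dist2 _ _ _ e34 e45).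
- move=> /andP[/eqP c36 /eqP c41]; have := K22 _ _ _ _ e34 e61 c36 c41.
  by rewrite s' (dist2 _ _ _ e12 e23) s' (dist2 _ _ _ e45 e56).
- rewrite s' in e45; have := K22 _ _ _ _ e12 e45 c15 c24.
  by rewrite (s' v5) => /orP[]->; rewrite ?orbT.
- move=> /andP[/eqP c26 /eqP c35]; rewrite s' in e56.
  have := K22 _ _ _ _ e23 e56 c26 c35.
  by rewrite (s' v6) => /orP[]->; rewrite ?orbT.
- move=> /andP[/eqP c31 /eqP c46]; rewrite s' in e61.
  have := K22 _ _ _ _ e34 e61 c31 c46.
  by move=> /orP[]->; rewrite ?orbT.
Qed.

(** * Minimum degree, chromatic number and density *)

Lemma bigmin_leq (I : eqType) (k : nat) (F : I -> nat) (s : seq I) x :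
  x \in s -> \big[minn/k]_(i <- s) F i <= F x.
Proof.
elim: s => // y s IHs; rewrite inE big_cons geq_min.
by case/predU1P=> [-> | /IHs ->]; rewrite ?leqnn ?orbT.
Qed.

Lemma min_degree_leq (G : sgraph) (x : G) :
  min_degree G <= #|[set y : G | adj x y]|.
Proof. by apply: (bigmin_leq _ (@degree G)); rewrite mem_index_enum. Qed.

Lemma chromatic_number_colouring (G : sgraph) (k : nat) :
  chromatic_number G <= k ->
  exists f : G -> 'I_k, forall x y, adj x y -> f x != f y.
Proof.
rewrite /chromatic_number; case: ex_minnP => m /existsP[f fP] _ mk.
exists (fun x => widen_ord mk (f x)) => x y xy.
by move/forallP/(_ x)/forallP/(_ y)/implyP/(_ xy): fP.
Qed.

Local Open Scope ring_scope.

Lemma sparse_half_not_dense (G : sgraph) :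
  (exists2 S : {set G}, #|S| = #|G|./2 &
    (50 * #|edges_within (@adj G) S| <= #|G| * #|G|)%N) ->
  ~ is_dense (1 / 2%:R : rat) (1 / 50%:R : rat) G.
Proof.
move=> [S cS le] /(_ S); rewrite cS => dense.
have : (#|G|./2)%:Z = Num.floor (1 / 2 * #|G|%:R : rat).
  apply/esym/floor_def; rewrite intrD -!pmulrn.
  have nE : #|G|%:R = (odd #|G|)%:R + 2 * (#|G|./2)%:R :> rat.
    by rewrite -natrM -natrD mul2n odd_double_half.
  by rewrite nE; apply/andP; case: (odd _); split=> /=; lra.
move/dense; apply/negP; rewrite -leNgt.
have : (50 * #|edges_in S|)%:R <= (#|G| * #|G|)%:R :> rat by rewrite ler_nat.
rewrite [X in X <= _]natrM [X in _ <= X]natrM -expr2; lra.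
Qed.

Theorem corollary1p3 (G : sgraph) (tfG : triangle_free G) :
  ((10%:R * #|G|%:R / 29%:R < (min_degree G)%:R :> rat) ->
     ~ is_dense (1 / 2%:R : rat) (1 / 50%:R : rat) G)
  /\
  ((#|G|%:R / 3%:R < (min_degree G)%:R :> rat) ->
     (chromatic_number G <= 3)%N ->
     ~ is_dense (1 / 2%:R : rat) (1 / 50%:R : rat) G).
Proof.
split=> [dG | dG colG]; apply: sparse_half_not_dense.
  apply: (sparse_half_10_29 (@adj_sym G) tfG (@min_degree_leq G)).
  by move: dG; rewrite ltr_pdivrMr ?ltr0n // -!natrM ltr_nat mulnC [(_ * 29)%N]mulnC mulnC.
apply: (sparse_half_3col (@adj_sym G) tfG (@min_degree_leq G)).
  by move: dG; rewrite ltr_pdivrMr ?ltr0n // -natrM ltr_nat mulnC.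
exact: chromatic_number_colouring.
Qed.
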